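(* Let $0<|q|<1$ and let $a,c,e$ be complex parameters such that all denominators below are nonzero. Then \[\frac{(a;q)_\infty(c;q)_\infty}{(ae;q)_\infty(c/e;q)_\infty} =\sum_{k=0}^{\infty}\frac{(ac)^k}{(q;q)_{2k}}\, \frac{(e;q)_k(ae/c;q)_k}{(ae;q)_k}\, \frac{(q/e;q)_k(qc/ae;q)_k}{(c/e;q)_k}\,q^{k^2-k} \left\{1+q^k\frac{c(1-q^ke)(1-q^kae/c)}{e(1-q^{1+2k})(1-q^kc/e)}\right\}.\]
   Context: For an indeterminate $x$ and $n\in\mathbb{N}_0$, $(x;q)_0=1$, $(x;q)_n=(1-x)(1-qx)\cdots(1-q^{n-1}x)$, and $(x;q)_\infty=\prod_{j\ge0}(1-q^jx)$ for $|q|<1$. *)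

(* Defs.v *)
From Stdlib Require Import Reals.
From Coquelicot Require Import Coquelicot.

Open Scope C_scope.

(** The q-shifted factorial (x;q)_n. *)
Fixpoint qpoch (x q : C) (n : nat) : C :=
  match n with
  | O => 1
  | S m => qpoch x q m * (1 - q ^ m * x)
  end.

(** (x;q)_oo, the limit of the partial products in [C].  The description
    operator [iota] is total; the limit exists whenever [Cmod q < 1]. *)
Definition qpoch_inf (x q : C) : C :=
  iota (T := C_CompleteNormedModule)
    (fun l : C => filterlim (qpoch x q) eventually (locally l)).

(* Main.v *)
(** Write [t_k(a, c)] for the k-th term of the series.  The terms satisfy
    [(1 - ae)(1 - c/e) t_k(a, c) - (1 - a)(1 - c) t_k(qa, qc) = G_k - G_(k+1)]
    with [G_k] an explicit rational multiple of the factor of [t_k] outside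
    the braces, [G_0 = 0] and [G_k -> 0].  So the sum [T(a, c)] satisfies the same first-order
    q-difference equation as the infinite product, and iterating gives
    [(ae;q)_N (c/e;q)_N T(a, c) = (a;q)_N (c;q)_N T(q^N a, q^N c)].
    As [N] grows, [T(q^N a, q^N c)] tends to its zeroth term [1], since
    [|t_k(q^N a, q^N c) - [k = 0]| <= K |q|^N |ac|^k |q|^(k^2 - k)]
    uniformly in [N]. *)

Require Import Defs.
From Stdlib Require Import Reals Lra Lia.
From Coquelicot Require Import Coquelicot.

Open Scope C_scope.

(** * Limits of complex sequences *)

Definition tends (u : nat -> C) (l : C) : Prop :=
  is_lim_seq (fun n => Cmod (u n - l)) 0%R.

(** Links the real sequence of distances, on which comparison and arithmetic of real limits act,
    with the filter limits behind [is_series] and [qpoch_inf]. *)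
Lemma tends_filterlim (u : nat -> C) (l : C) :
  tends u l <-> filterlim u eventually (locally (T := C_NormedModule) l).
Proof.
  unfold tends. split; intro H.
  - apply (filterlim_locally_ball_norm (K := C_AbsRing) (U := C_NormedModule)).
    intro eps.
    apply is_lim_seq_spec in H. destruct (H eps) as [N HN].
    exists N. intros n Hn. specialize (HN n Hn).
    rewrite Rminus_0_r, Rabs_pos_eq in HN by apply Cmod_ge_0. exact HN.
  - apply is_lim_seq_spec. intro eps.
    apply (filterlim_locally_ball_norm (K := C_AbsRing) (U := C_NormedModule)) with (eps := eps) in H.
    destruct H as [N HN]. exists N. intros n Hn. specialize (HN n Hn).
    rewrite Rminus_0_r, Rabs_pos_eq by apply Cmod_ge_0. exact HN.
Qed.

Lemma tends_const (l : C) : tends (fun _ => l) l.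
Proof.
  unfold tends. apply is_lim_seq_ext with (fun _ => 0%R).
  - intros _. replace (l - l) with (RtoC 0) by ring. now rewrite Cmod_0.
  - apply is_lim_seq_const.
Qed.

Lemma tends_le (u : nat -> C) (l : C) (v : nat -> R) :
  (forall n, (Cmod (u n - l) <= v n)%R) -> is_lim_seq v 0%R -> tends u l.
Proof.
  intros H Hv. apply is_lim_seq_le_le with (fun _ => 0%R) v; auto.
  - intro n. split; [apply Cmod_ge_0 | apply H].
  - apply is_lim_seq_const.
Qed.

Lemma tends_unique (u : nat -> C) (l l' : C) : tends u l -> tends u l' -> l = l'.
Proof.
  intros H H'. apply tends_filterlim in H, H'.
  exact (filterlim_locally_unique (K := C_AbsRing) (V := C_NormedModule) u l l' H H').
Qed.

Lemma tends_mult (u v : nat -> C) (l m : C) :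
  tends u l -> tends v m -> tends (fun n => u n * v n) (l * m).
Proof.
  intros Hu Hv.
  apply tends_le with (fun n => Cmod (u n - l) * Cmod (v n - m) + Cmod m * Cmod (u n - l)
                                + Cmod l * Cmod (v n - m))%R.
  - intro n.
    replace (u n * v n - l * m) with ((u n - l) * (v n - m) + m * (u n - l) + l * (v n - m)) by ring.
    rewrite <- !Cmod_mult.
    eapply Rle_trans; [apply Cmod_triangle |]. apply Rplus_le_compat_r, Cmod_triangle.
  - replace 0%R with (0 * 0 + Cmod m * 0 + Cmod l * 0)%R by ring.
    repeat (apply is_lim_seq_plus' || apply is_lim_seq_mult' || apply is_lim_seq_const || assumption).
Qed.

Lemma tends_plus (u v : nat -> C) (l m : C) :
  tends u l -> tends v m -> tends (fun n => u n + v n) (l + m).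
Proof.
  intros Hu Hv.
  apply tends_le with (fun n => Cmod (u n - l) + Cmod (v n - m))%R.
  - intro n.
    replace (u n + v n - (l + m)) with ((u n - l) + (v n - m)) by ring.
    apply Cmod_triangle.
  - replace 0%R with (0 + 0)%R by ring. now apply is_lim_seq_plus'.
Qed.

Lemma tends_ext (u v : nat -> C) (l : C) : (forall n, u n = v n) -> tends u l -> tends v l.
Proof.
  intros E. apply is_lim_seq_ext. intro n. now rewrite E.
Qed.

Lemma tends_incr_1 (u : nat -> C) (l : C) : tends (fun n => u (S n)) l <-> tends u l.
Proof.
  symmetry. apply (is_lim_seq_incr_1 (fun n => Cmod (u n - l))).
Qed.

(** * Elementary estimates for the modulus *)

Lemma one_minus_lower (z : C) : (1 - Cmod z <= Cmod (1 - z))%R.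
Proof.
  pose proof (Cmod_triangle (1 - z) z) as H.
  replace (1 - z + z) with (RtoC 1) in H by ring. rewrite Cmod_1 in H. lra.
Qed.

Lemma one_minus_upper (z : C) : (Cmod (1 - z) <= 1 + Cmod z)%R.
Proof.
  pose proof (Cmod_triangle 1 (- z)) as H. rewrite Cmod_1, Cmod_opp in H. exact H.
Qed.

Lemma Cmod_div_le (x y : C) (M m : R) :
  (Cmod x <= M -> 0 < m -> m <= Cmod y -> Cmod (x / y) <= M / m)%R.
Proof.
  intros Hx Hm Hy.
  assert (y <> 0) by (intro E; rewrite E, Cmod_0 in Hy; lra).
  rewrite Cmod_div by assumption.
  apply Rmult_le_compat; auto using Cmod_ge_0.
  - apply Rlt_le, Rinv_0_lt_compat. lra.
  - now apply Rinv_le_contravar.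
Qed.

Lemma Cmod_mult_le (x y : C) (M N : R) :
  (Cmod x <= M -> Cmod y <= N -> Cmod (x * y) <= M * N)%R.
Proof.
  intros. rewrite Cmod_mult. apply Rmult_le_compat; auto using Cmod_ge_0.
Qed.

(** * Algebra of q-shifted factorials, and the majorant series *)

Lemma qpoch_add (x q : C) (n m : nat) :
  qpoch x q (n + m) = qpoch x q n * qpoch (q ^ n * x) q m.
Proof.
  induction m as [|m IH]; simpl.
  - rewrite Nat.add_0_r. ring.
  - rewrite Nat.add_succ_r. simpl. rewrite IH, Cpow_add_r. ring.
Qed.

Lemma qpoch_succ_l (x q : C) (n : nat) :
  qpoch x q (S n) = (1 - x) * qpoch (q * x) q n.
Proof.
  change (S n) with (1 + n)%nat. rewrite qpoch_add. simpl.
  replace (q * 1 * x) with (q * x) by ring. ring.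
Qed.

Lemma qpoch_factor_neq0 (x q : C) (n : nat) :
  qpoch x q (S n) <> 0 -> 1 - q ^ n * x <> 0.
Proof.
  intros H E. apply H. simpl. rewrite E. ring.
Qed.

(** D'Alembert's test: consecutive terms have ratio [x * (p ^ 2) ^ k], which tends to 0 however
    large [x] is. This series dominates all the sums below. *)
Lemma ex_series_weight (x p : R) : (0 < x -> 0 < p < 1 ->
  ex_series (fun k : nat => x ^ k * p ^ (k ^ 2 - k)))%R.
Proof.
  intros Hx Hp.
  set (w := fun k : nat => (x ^ k * p ^ (k ^ 2 - k))%R).
  assert (Hw : forall k, (0 < w k)%R) by (intro k; apply Rmult_lt_0_compat; apply pow_lt; lra).
  apply ex_series_ext with (fun k => Rabs (w k)).
  { intro k. apply Rabs_pos_eq. apply Rlt_le, Hw. }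
  apply ex_series_DAlembert with 0%R; [lra | intro k; specialize (Hw k); lra |].
  apply is_lim_seq_ext with (fun k => x * (p ^ 2) ^ k)%R.
  - intro k.
    replace (w (S k)) with (x * (p ^ 2) ^ k * w k)%R.
    + rewrite Rabs_pos_eq.
      * field. specialize (Hw k). lra.
      * replace (x * (p ^ 2) ^ k * w k / w k)%R with (x * (p ^ 2) ^ k)%R
          by (field; specialize (Hw k); lra).
        apply Rmult_le_pos; [lra | apply pow_le; nra].
    + unfold w. replace (S k ^ 2 - S k)%nat with ((k ^ 2 - k) + 2 * k)%nat by (simpl; nia).
      rewrite pow_add, pow_mult. simpl. ring.
  - replace 0%R with (x * 0)%R by ring.
    apply is_lim_seq_mult'; [apply is_lim_seq_const |].
    apply is_lim_seq_geom. rewrite Rabs_pos_eq; nra.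
Qed.

(** * The summand, split as [head] (outside the braces) times [1 + corr] (the braces), and its
    certificate *)

Definition head (q a c e : C) (k : nat) : C :=
  (a * c) ^ k / qpoch q q (2 * k)
  * (qpoch e q k * qpoch (a * e / c) q k / qpoch (a * e) q k)
  * (qpoch (q / e) q k * qpoch (q * c / (a * e)) q k / qpoch (c / e) q k)
  * q ^ (k ^ 2 - k).

Definition corr (q a c e : C) (k : nat) : C :=
  q ^ k * (c * (1 - q ^ k * e) * (1 - q ^ k * (a * e / c))
           / (e * (1 - q ^ (1 + 2 * k)) * (1 - q ^ k * (c / e)))).

Definition term (q a c e : C) (k : nat) : C := head q a c e k * (1 + corr q a c e k).

(* [G_k] of the header. *)
Definition certificate (q a c e : C) (k : nat) : C :=
  (1 - a * e) * (1 - c / e) * head q a c e k * ((1 - q ^ (2 * k)) / (1 - q ^ k * (c / e))).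

(** Nonvanishing for all [n] says that no single factor [1 - q ^ n * (a * e)] or
    [1 - q ^ n * (c / e)] vanishes, a condition that survives the shift of [a] and [c] by [q]. *)
Definition admissible (q a c e : C) : Prop :=
  a <> 0 /\ c <> 0 /\ e <> 0 /\
  (forall n, qpoch (a * e) q n <> 0) /\ (forall n, qpoch (c / e) q n <> 0).

Lemma head_0 (q a c e : C) : head q a c e 0 = 1.
Proof.
  unfold head. simpl. field.
Qed.

(** * Two-sided bounds for q-shifted factorials, and the infinite product *)

Section ContractingBase.

Context (q : C) (hq0 : (0 < Cmod q)%R) (hq1 : (Cmod q < 1)%R).

Lemma Cmod_qpow_le (n : nat) : (0 < Cmod (q ^ n) <= 1)%R.
Proof.
  rewrite Cmod_pow. split.
  - now apply pow_lt.
  - rewrite <- (pow1 n). apply pow_incr. lra.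
Qed.

Lemma qpow_succ_lower (n : nat) : (1 - Cmod q <= Cmod (1 - q ^ S n))%R.
Proof.
  eapply Rle_trans; [| apply one_minus_lower].
  rewrite Cpow_S, Cmod_mult. pose proof (Cmod_qpow_le n). nra.
Qed.

Lemma qpow_succ_neq1 (n : nat) : 1 - q ^ S n <> 0.
Proof.
  intro E. pose proof (qpow_succ_lower n) as H. rewrite E, Cmod_0 in H. lra.
Qed.

Lemma qpoch_q_neq0 (n : nat) : qpoch q q n <> 0.
Proof.
  induction n as [|n IH]; simpl.
  - intro E. apply RtoC_inj in E. lra.
  - apply Cmult_neq_0; auto. rewrite Cmult_comm. apply (qpow_succ_neq1 n).
Qed.

(** Each factor satisfies [|1 - q^j x| <= 1 + |q|^j |x| <= exp (|q|^j |x|)], and the exponents form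
    a geometric series with sum [|x| / (1 - |q|)]. The induction carries the exact partial sum in
    the exponent. *)
Lemma qpoch_upper (x : C) : exists M : R, (0 < M)%R /\ forall n, (Cmod (qpoch x q n) <= M)%R.
Proof.
  set (p := Cmod q) in *.
  exists (exp (Cmod x / (1 - p))). split; [apply exp_pos |].
  assert (Hn : forall n, (Cmod (qpoch x q n) <= exp (Cmod x * (1 - p ^ n) / (1 - p)))%R).
  { induction n as [|n IH]; simpl.
    - rewrite Cmod_1. replace (Cmod x * (1 - 1) / (1 - p))%R with 0%R by (field; lra).
      rewrite exp_0. lra.
    - rewrite Cmod_mult.
      replace (Cmod x * (1 - p * p ^ n) / (1 - p))%R
        with (Cmod x * (1 - p ^ n) / (1 - p) + p ^ n * Cmod x)%R by (field; lra).
      rewrite exp_plus. apply Rmult_le_compat; auto using Cmod_ge_0.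
      eapply Rle_trans; [apply one_minus_upper |].
      rewrite Cmod_mult, Cmod_pow. fold p. apply exp_ineq1_le. }
  intro n. eapply Rle_trans; [apply Hn |].
  assert (0 <= p ^ n)%R by (apply pow_le; lra).
  pose proof (Cmod_ge_0 x).
  assert (L : (Cmod x * (1 - p ^ n) / (1 - p) <= Cmod x / (1 - p))%R).
  { apply Rmult_le_compat_r; [apply Rlt_le, Rinv_0_lt_compat; lra | nra]. }
  destruct L as [L | L]; [left; now apply exp_increasing | rewrite L; lra].
Qed.

(* Inductively [|(x;q)_n| >= 1 - (u_0 + ... + u_(n-1))] with [u_j = |q|^j |x|]. *)
Lemma qpoch_lower_small (x : C) (n : nat) :
  (Cmod x <= (1 - Cmod q) / 2 -> / 2 <= Cmod (qpoch x q n))%R.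
Proof.
  set (p := Cmod q) in *. intro Hx.
  pose proof (Cmod_ge_0 x) as Hx0.
  (* [s] is the full geometric sum of the [u_j] and [s * (1 - p ^ n)] the partial one; the smallness
     hypothesis amounts to [s <= 1/2]. *)
  set (s := (Cmod x / (1 - p))%R).
  assert (Hs : (Cmod x = s * (1 - p))%R) by (unfold s; field; lra).
  assert (Hs0 : (0 <= s)%R) by (apply Rmult_le_pos; [lra | apply Rlt_le, Rinv_0_lt_compat; lra]).
  assert (Hs1 : (s <= / 2)%R) by nra.
  assert (Hp : forall n, (0 <= p ^ n <= 1)%R).
  { intro k. pose proof (Cmod_qpow_le k) as H. rewrite Cmod_pow in H. unfold p. lra. }
  assert (H : (1 - s * (1 - p ^ n) <= Cmod (qpoch x q n))%R).
  { induction n as [|n IH]; simpl.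
    - rewrite Cmod_1. lra.
    - rewrite Cmod_mult. pose proof (one_minus_lower (q ^ n * x)) as Hu.
      rewrite Cmod_mult, Cmod_pow, Hs in Hu. fold p in Hu. specialize (Hp n).
      set (t := (p ^ n)%R) in *.
      assert (0 <= s * (1 - t) <= /2)%R by nra.
      assert (0 <= t * (s * (1 - p)) <= /2)%R by nra.
      (* This is [(1 - A) * (1 - B) >= 1 - A - B] for [A, B >= 0], with [A] the partial sum so far
         and [B] the next [u_n]. *)
      apply Rle_trans with ((1 - s * (1 - t)) * (1 - t * (s * (1 - p))))%R.
      + assert (0 <= (s * (1 - t)) * (t * (s * (1 - p))))%R by (apply Rmult_le_pos; lra). nra.
      + apply Rmult_le_compat; lra. }
  specialize (Hp n). nra.
Qed.

(** Finitely many leading factors, each nonzero, are split off until the remaining argument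
    [q ^ N * x] is small enough for [qpoch_lower_small]. The induction is on the number [N] of
    factors split off. *)
Lemma qpoch_lower (x : C) : (forall n, qpoch x q n <> 0) ->
  exists m : R, (0 < m)%R /\ forall n, (m <= Cmod (qpoch x q n))%R.
Proof.
  assert (H : forall N x, (Cmod q ^ N * Cmod x <= (1 - Cmod q) / 2)%R ->
     (forall n, qpoch x q n <> 0) ->
     exists m : R, (0 < m)%R /\ forall n, (m <= Cmod (qpoch x q n))%R).
  { induction N as [|N IH]; intros y Hy Hnz.
    - exists (/ 2)%R. split; [lra |]. intro n. apply qpoch_lower_small. simpl in Hy. lra.
    - destruct (IH (q * y)) as [m [Hm Hmn]].
      + rewrite Cmod_mult. simpl in Hy. lra.
      + intros n E. apply (Hnz (S n)). rewrite qpoch_succ_l, E. ring.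
      + assert (Hy1 : (0 < Cmod (1 - y))%R).
        { apply Cmod_gt_0. intro E. apply (Hnz 1%nat). rewrite qpoch_succ_l, E. ring. }
        (* The entry 1 of the minimum covers the empty product at [n = 0]. *)
        exists (Rmin 1 (Cmod (1 - y) * m)). split.
        * apply Rmin_pos; [lra | now apply Rmult_lt_0_compat].
        * intros [|n].
          -- simpl. rewrite Cmod_1. apply Rmin_l.
          -- rewrite qpoch_succ_l, Cmod_mult. eapply Rle_trans; [apply Rmin_r |].
             apply Rmult_le_compat_l; [lra | apply Hmn]. }
  assert (L : is_lim_seq (fun n => Cmod q ^ n * Cmod x)%R (0 * Cmod x)%R).
  { apply is_lim_seq_mult'; [| apply is_lim_seq_const].
    apply is_lim_seq_geom. rewrite Rabs_pos_eq; lra. }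
  rewrite Rmult_0_l in L. apply is_lim_seq_spec in L.
  assert (Hpos : (0 < (1 - Cmod q) / 2)%R) by lra.
  destruct (L (mkposreal _ Hpos)) as [N HN].
  apply (H N). specialize (HN N (le_n N)). simpl in HN.
  rewrite Rminus_0_r in HN. apply Rabs_def2 in HN. lra.
Qed.

(** A tail is the quotient of [(x;q)_(N+n)] by [(x;q)_N]; a lower bound for the former and an upper
    bound for the latter give a bound uniform in [N]. *)
Lemma qpoch_tail_lower (x : C) : (forall n, qpoch x q n <> 0) ->
  exists m : R, (0 < m)%R /\ forall N n, (m <= Cmod (qpoch (q ^ N * x) q n))%R.
Proof.
  intro Hnz. destruct (qpoch_lower x Hnz) as [m [Hm Hmn]].
  destruct (qpoch_upper x) as [M [HM HMn]].
  exists (m / M)%R. split; [now apply Rdiv_lt_0_compat |].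
  intros N n. apply Rle_div_l; [lra |].
  eapply Rle_trans; [apply (Hmn (N + n)%nat) |].
  rewrite qpoch_add, Cmod_mult, Rmult_comm.
  apply Rmult_le_compat_l; [apply Cmod_ge_0 | apply HMn].
Qed.

(** The increments [(x;q)_(n+1) - (x;q)_n = - (x;q)_n q^n x] are dominated by a geometric series,
    since the partial products are bounded. *)
Lemma qpoch_cvg (x : C) : tends (qpoch x q) (qpoch_inf x q).
Proof.
  assert (E : exists l : C, tends (qpoch x q) l).
  { destruct (qpoch_upper x) as [M [HM HMn]].
    destruct (ex_series_le (K := C_AbsRing) (V := C_CompleteNormedModule)
      (fun n => - (qpoch x q n * (q ^ n * x))) (fun n => M * Cmod x * Cmod q ^ n)%R) as [l Hl].
    - intro n. change (Cmod (- (qpoch x q n * (q ^ n * x))) <= M * Cmod x * Cmod q ^ n)%R.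
      rewrite Cmod_opp, !Cmod_mult, Cmod_pow.
      replace (M * Cmod x * Cmod q ^ n)%R with (M * (Cmod q ^ n * Cmod x))%R by ring.
      apply Rmult_le_compat_r; [| apply HMn].
      apply Rmult_le_pos; [apply pow_le; lra | apply Cmod_ge_0].
    - apply (ex_series_scal_l (K := R_AbsRing) (V := R_NormedModule) (M * Cmod x)%R).
      apply ex_series_geom. rewrite Rabs_pos_eq; lra.
    (* [sum_n] includes the index [n], so the sum of increments plus [(x;q)_0 = 1] is the product of
       length [n + 1]. *)
    - exists (l + 1). apply tends_incr_1.
      apply tends_ext with (fun n => sum_n (G := C_AbelianMonoid) (fun n => - (qpoch x q n * (q ^ n * x))) n + 1).
      + induction n as [|n IH].
        * rewrite sum_O. simpl. ring.
        * rewrite sum_Sn. 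
          change (plus (G := C_AbelianMonoid)) with Cplus. 
          rewrite <- Cplus_assoc, (Cplus_comm (- _) 1), Cplus_assoc, IH. simpl. ring.
      + apply tends_plus; [| apply tends_const]. apply tends_filterlim. exact Hl. }
  destruct E as [l Hl]. unfold qpoch_inf.
  rewrite (iota_filterlim_locally (V := C_CompleteNormedModule) (qpoch x q) l); auto.
  now apply tends_filterlim.
Qed.

(** The positive lower bound for the finite products passes to the limit. *)
Lemma qpoch_inf_neq0 (x : C) : (forall n, qpoch x q n <> 0) -> qpoch_inf x q <> 0.
Proof.
  intros Hnz E. destruct (qpoch_lower x Hnz) as [m [Hm Hmn]].
  pose proof (qpoch_cvg x) as H. rewrite E in H. unfold tends in H.
  assert (L : Rbar_le m 0%R).
  { apply is_lim_seq_le with (fun _ : nat => m) (fun n => Cmod (qpoch x q n - 0)).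
    - intro n. replace (qpoch x q n - 0) with (qpoch x q n) by ring. apply Hmn.
    - apply is_lim_seq_const.
    - exact H. }
  simpl in L. lra.
Qed.

(** * The telescoping identity for the terms *)

Lemma q_neq0 : q <> 0.
Proof. now apply Cmod_gt_0. Qed.

Lemma admissible_shift (a c e : C) : admissible q a c e -> admissible q (q * a) (q * c) e.
Proof.
  intros (ha & hc & he & hae & hce). pose proof q_neq0.
  repeat split; auto using Cmult_neq_0.
  - intros n E. apply (hae (S n)). rewrite qpoch_succ_l, Cmult_assoc, E. ring.
  - intros n E. apply (hce (S n)). rewrite qpoch_succ_l.
    unfold Cdiv in *. rewrite Cmult_assoc, E. ring.
Qed.

(** With [head_shift], this expresses every quantity in the telescoping identity as [head q a c e k]
    times a rational function of [q ^ k]. *)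
Lemma head_succ (a c e : C) (k : nat) : admissible q a c e ->
  head q a c e (S k) =
  head q a c e k *
  (a * c * (q ^ k) ^ 2 * (1 - q ^ k * e) * (1 - q ^ k * (a * e / c)) * (1 - q ^ k * (q / e))
   * (1 - q ^ k * (q * c / (a * e)))
   / ((1 - q ^ (1 + 2 * k)) * (1 - q ^ (2 + 2 * k)) * (1 - q ^ k * (a * e)) * (1 - q ^ k * (c / e)))).
Proof.
  intros (ha & hc & he & hae & hce).
  pose proof (qpoch_factor_neq0 _ _ _ (hae (S k))) as h1.
  pose proof (qpoch_factor_neq0 _ _ _ (hce (S k))) as h2.
  pose proof (qpow_succ_neq1 (2 * k)) as h3.
  pose proof (qpow_succ_neq1 (S (2 * k))) as h4.
  pose proof (qpoch_q_neq0 (2 * k)) as h5.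
  specialize (hae k). specialize (hce k).
  unfold head.
  replace (S k ^ 2 - S k)%nat with ((k ^ 2 - k) + 2 * k)%nat by (simpl; nia).
  replace (2 * S k)%nat with (S (S (2 * k))) by lia.
  rewrite (Cpow_add_r q (k ^ 2 - k)).
  change (1 + 2 * k)%nat with (S (2 * k)). change (2 + 2 * k)%nat with (S (S (2 * k))).
  cbn [qpoch]. rewrite (Cpow_S _ k), <- (Cmult_comm q (q ^ (2 * k))).
  replace (q ^ S (2 * k) * q) with (q ^ S (S (2 * k))) by (rewrite (Cpow_S q (S _)); ring).
  rewrite <- !(Cpow_S q (2 * k)).
  replace (q ^ (2 * k)) with ((q ^ k) ^ 2) by (rewrite Nat.mul_comm; now rewrite Cpow_mult_r).
  replace (Cpow (q ^ k) 2) with (q ^ k * q ^ k) by (simpl; ring).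
  set (D1 := 1 - q ^ S (2 * k)) in *. set (D2 := 1 - q ^ S (S (2 * k))) in *.
  set (D3 := 1 - q ^ k * (a * e)) in *. set (D4 := 1 - q ^ k * (c / e)) in *.
  set (N2 := 1 - q ^ k * (a * e / c)). set (N3 := 1 - q ^ k * (q / e)).
  set (N4 := 1 - q ^ k * (q * c / (a * e))).
  generalize dependent (qpoch q q (2 * k)). intros.
  generalize dependent (qpoch (a * e) q k). intros.
  generalize dependent (qpoch (c / e) q k). intros.
  generalize (qpoch (a * e / c) q k). intros.
  generalize (qpoch (q * c / (a * e)) q k). intros.
  generalize (qpoch (q / e) q k). intros.
  clearbody D1 D2 D3 D4 N2 N3 N4.
  field. repeat split; auto.
Qed.

(** The arguments [a * e / c] and [q * c / (a * e)] are invariant under the shift. Only the power of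
    [a * c] changes, by [q ^ (2 * k)], and the two denominators, by
    [(qx;q)_k = (x;q)_k (1 - q^k x) / (1 - x)]. *)
Lemma head_shift (a c e : C) (k : nat) : admissible q a c e ->
  head q (q * a) (q * c) e k =
  head q a c e k * ((q ^ k) ^ 2 * (1 - a * e) * (1 - c / e)
   / ((1 - q ^ k * (a * e)) * (1 - q ^ k * (c / e)))).
Proof.
  intros (ha & hc & he & hae & hce). pose proof q_neq0 as hq.
  pose proof (qpoch_factor_neq0 _ _ _ (hae 1%nat)) as h0.
  pose proof (qpoch_factor_neq0 _ _ _ (hce 1%nat)) as h0'.
  pose proof (qpoch_factor_neq0 _ _ _ (hae (S k))) as h1.
  pose proof (qpoch_factor_neq0 _ _ _ (hce (S k))) as h2.
  pose proof (qpoch_q_neq0 (2 * k)) as h5.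
  simpl in h0, h0'. rewrite Cmult_1_l in h0, h0'.
  pose proof (qpoch_succ_l (a * e) q k) as E1.
  pose proof (qpoch_succ_l (c / e) q k) as E2.
  assert (F1 := hae (S k)). assert (F2 := hce (S k)).
  rewrite E1 in F1. rewrite E2 in F2.
  cbn [qpoch] in E1, E2. specialize (hae k). specialize (hce k).
  unfold head.
  replace (q * a * (q * c)) with (q * q * (a * c)) by ring.
  rewrite Cpow_mult_l, Cpow_mult_l.
  replace (q * a * e / (q * c)) with (a * e / c) by (field; auto).
  replace (q * (q * c) / (q * a * e)) with (q * c / (a * e)) by (field; auto).
  replace (q * a * e) with (q * (a * e)) by ring.
  replace (q * c / e) with (q * (c / e)) by (field; auto).
  replace (qpoch (q * (a * e)) q k) with (qpoch (a * e) q k * (1 - q ^ k * (a * e)) / (1 - a * e))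
    by (rewrite E1; field; auto).
  replace (qpoch (q * (c / e)) q k) with (qpoch (c / e) q k * (1 - q ^ k * (c / e)) / (1 - c / e))
    by (rewrite E2; generalize dependent (c / e); intros; field; auto).
  replace (Cpow (q ^ k) 2) with (q ^ k * q ^ k) by (simpl; ring).
  clear E1 E2 F1 F2.
  set (D3 := 1 - q ^ k * (a * e)) in *. set (D4 := 1 - q ^ k * (c / e)) in *.
  set (D1 := 1 - a * e) in *. set (D2 := 1 - c / e) in *.
  generalize dependent (qpoch q q (2 * k)). intros.
  generalize dependent (qpoch (a * e) q k). intros.
  generalize dependent (qpoch (c / e) q k). intros.
  generalize (qpoch (a * e / c) q k). intros.
  generalize (qpoch (q * c / (a * e)) q k). intros.
  generalize (qpoch (q / e) q k). intros.
  clearbody D1 D2 D3 D4.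
  field. repeat split; auto.
Qed.

(** Once [head q a c e k] is factored out, both sides are rational functions of [a], [c], [e], [q]
    and [Q = q ^ k], and the identity is checked by clearing denominators. *)
Lemma term_telescopes (a c e : C) (k : nat) : admissible q a c e ->
  (1 - a * e) * (1 - c / e) * term q a c e k
  - (1 - a) * (1 - c) * term q (q * a) (q * c) e k
  = certificate q a c e k - certificate q a c e (S k).
Proof.
  intros H. unfold term, certificate. rewrite head_shift, head_succ by assumption.
  destruct H as (ha & hc & he & hae & hce). pose proof q_neq0 as hq.
  pose proof (qpoch_factor_neq0 _ _ _ (hae (S k))) as h1.
  pose proof (qpoch_factor_neq0 _ _ _ (hce (S k))) as h2.
  pose proof (qpoch_factor_neq0 _ _ _ (hce (S (S k)))) as h2'.
  pose proof (qpow_succ_neq1 (2 * k)) as h3.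
  pose proof (qpow_succ_neq1 (S (2 * k))) as h4.
  unfold corr.
  replace (2 * S k)%nat with (S (S (2 * k))) by lia.
  change (1 + 2 * k)%nat with (S (2 * k)). change (2 + 2 * k)%nat with (S (S (2 * k))).
  rewrite !Cpow_S in *.
  replace (q ^ (2 * k)) with (q ^ k * q ^ k) in * by (rewrite Nat.mul_comm, Cpow_mult_r; simpl; ring).
  replace (Cpow (q ^ k) 2) with (q ^ k * q ^ k) by (simpl; ring).
  generalize (head q a c e k). intro A.
  generalize dependent (q ^ k). intros Q h1 h2 h2' h3 h4.
  (* Multiplied by [e], the factors [1 - Q * (c / e)] and [1 - q * Q * (c / e)] become polynomial;
     the second one comes from the certificate at [k + 1]. *)
  assert (d2 : e - Q * c <> 0).
  { intro E. apply h2. replace (1 - Q * (c / e)) with ((e - Q * c) / e) by (field; auto).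
    rewrite E. field; auto. }
  assert (d2' : e - q * Q * c <> 0).
  { intro E. apply h2'. replace (1 - q * Q * (c / e)) with ((e - q * Q * c) / e) by (field; auto).
    rewrite E. field; auto. }
  field. repeat split; auto.
Qed.

(** * Estimates for the terms, uniform in the number [N] of shifts, and convergence *)

Lemma qpoch_factor_lower (x : C) : (forall n, qpoch x q n <> 0) ->
  exists m : R, (0 < m)%R /\ forall n, (m <= Cmod (1 - q ^ n * x))%R.
Proof.
  intro Hnz. destruct (qpoch_tail_lower x Hnz) as [m [Hm Hmn]].
  (* A single factor is a tail of length one. *)
  exists m. split; auto. intro n. specialize (Hmn n 1%nat). simpl in Hmn.
  now rewrite !Cmult_1_l in Hmn.
Qed.

Lemma admissible_iter (a c e : C) (N : nat) :
  admissible q a c e -> admissible q (q ^ N * a) (q ^ N * c) e.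
Proof.
  intro H. induction N as [|N IH].
  - simpl. now rewrite !Cmult_1_l.
  - rewrite !Cpow_S, <- !Cmult_assoc. now apply admissible_shift.
Qed.

(** The numerator factorials do not depend on [N], the shifted denominators are tails with a uniform
    lower bound, and the decay in [N] comes from the power of [a * c]. *)
Lemma head_bound (a c e : C) : admissible q a c e ->
  exists K : R, (0 < K)%R /\ forall N k,
    (Cmod (head q (q ^ N * a) (q ^ N * c) e k)
     <= K * ((Cmod q ^ N) ^ k * (Cmod (a * c) ^ k * Cmod q ^ (k ^ 2 - k))))%R.
Proof.
  intros (ha & hc & he & hae & hce). pose proof (q_neq0) as hq.
  destruct (qpoch_upper e) as [M1 [HM1 B1]].
  destruct (qpoch_upper (a * e / c)) as [M2 [HM2 B2]].
  destruct (qpoch_upper (q / e)) as [M3 [HM3 B3]].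
  destruct (qpoch_upper (q * c / (a * e))) as [M4 [HM4 B4]].
  destruct (qpoch_lower q qpoch_q_neq0) as [m1 [Hm1 L1]].
  destruct (qpoch_tail_lower _ hae) as [m2 [Hm2 L2]].
  destruct (qpoch_tail_lower _ hce) as [m3 [Hm3 L3]].
  exists (/ m1 * (M1 * M2 / m2) * (M3 * M4 / m3))%R. split.
  { repeat (apply Rmult_lt_0_compat || apply Rinv_0_lt_compat || assumption). }
  intros N k. pose proof (Cpow_nz q N hq) as hN.
  unfold head.
  replace (q ^ N * a * e / (q ^ N * c)) with (a * e / c) by (field; auto).
  replace (q * (q ^ N * c) / (q ^ N * a * e)) with (q * c / (a * e)) by (field; auto).
  replace (q ^ N * a * e) with (q ^ N * (a * e)) by ring.
  replace (q ^ N * c / e) with (q ^ N * (c / e)) by (field; auto).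
  set (W := ((Cmod q ^ N) ^ k * Cmod (a * c) ^ k)%R).
  replace (/ m1 * (M1 * M2 / m2) * (M3 * M4 / m3)
           * ((Cmod q ^ N) ^ k * (Cmod (a * c) ^ k * Cmod q ^ (k ^ 2 - k))))%R
    with (W / m1 * (M1 * M2 / m2) * (M3 * M4 / m3) * Cmod q ^ (k ^ 2 - k))%R
    by (unfold W; field; lra).
  apply Cmod_mult_le; [| rewrite Cmod_pow; lra].
  apply Cmod_mult_le; [apply Cmod_mult_le |]; apply Cmod_div_le; auto using Cmod_mult_le.
  rewrite Cmod_pow. unfold W. rewrite <- Rpow_mult_distr.
  apply pow_incr. split; [apply Cmod_ge_0 |].
  (* The shift contributes [q ^ N] twice; one copy is kept and the other bounded by 1 in modulus. *)
  replace (q ^ N * a * (q ^ N * c)) with (q ^ N * (q ^ N * (a * c))) by ring.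
  rewrite Cmod_mult, (Cmod_mult (q ^ N) (a * c)), <- Cmod_pow.
  pose proof (Cmod_qpow_le N). pose proof (Cmod_ge_0 (a * c)).
  apply Rmult_le_compat_l; nra.
Qed.

(** The numerator factor [q ^ N * c] supplies [|q|^N]. In the denominator, [1 - q ^ (1 + 2 * k)] is
    at least [1 - |q|] in modulus, and the shifted last factor is the factor of index [k + N] for
    [c / e]. *)
Lemma corr_bound (a c e : C) : admissible q a c e ->
  exists K : R, (0 < K)%R /\ forall N k,
    (Cmod (corr q (q ^ N * a) (q ^ N * c) e k) <= K * Cmod q ^ N)%R.
Proof.
  intros (ha & hc & he & hae & hce). pose proof (q_neq0) as hq.
  destruct (qpoch_factor_lower _ hce) as [m [Hm L]].
  assert (he' : (0 < Cmod e)%R) by now apply Cmod_gt_0.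
  assert (hc' : (0 < Cmod c)%R) by now apply Cmod_gt_0.
  assert (U : forall x k, (Cmod (1 - q ^ k * x) <= 1 + Cmod x)%R).
  { intros x k. eapply Rle_trans; [apply one_minus_upper |].
    rewrite Cmod_mult. pose proof (Cmod_qpow_le k). pose proof (Cmod_ge_0 x). nra. }
  exists (Cmod c * (1 + Cmod e) * (1 + Cmod (a * e / c)) / (Cmod e * (1 - Cmod q) * m))%R.
  assert (Hd : (0 < Cmod e * (1 - Cmod q) * m)%R).
  { repeat apply Rmult_lt_0_compat; lra. }
  split.
  { pose proof (Cmod_ge_0 (a * e / c)).
    apply Rdiv_lt_0_compat; auto. repeat apply Rmult_lt_0_compat; lra. }
  intros N k. pose proof (Cpow_nz q N hq) as hN.
  unfold corr.
  replace (q ^ N * a * e / (q ^ N * c)) with (a * e / c) by (field; auto).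
  replace (q ^ k * (q ^ N * c / e)) with (q ^ (k + N) * (c / e)) by (rewrite Cpow_add_r; field; auto).
  change (1 + 2 * k)%nat with (S (2 * k)).
  match goal with |- (_ <= ?r)%R => replace r with
    (1 * (Cmod q ^ N * Cmod c * (1 + Cmod e) * (1 + Cmod (a * e / c)) / (Cmod e * (1 - Cmod q) * m)))%R
    by (field; repeat split; lra) end.
  apply Cmod_mult_le; [apply (Cmod_qpow_le k) |].
  apply Cmod_div_le; auto.
  - apply Cmod_mult_le; auto. apply Cmod_mult_le; auto.
    rewrite Cmod_mult, Cmod_pow. lra.
  - rewrite !Cmod_mult. pose proof (qpow_succ_lower (2 * k)).
    apply Rmult_le_compat; auto; [apply Rmult_le_pos; lra | lra |].
    apply Rmult_le_compat_l; lra.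
Qed.

(** The number subtracted is the limit of the term as [N] grows. At [k = 0] the head is 1 and only
    [corr] is left, giving the constant [L]; for [k >= 1] the head supplies [(|q|^N)^k <= |q|^N],
    giving [K * (1 + L)]. *)
Lemma term_bound (a c e : C) : admissible q a c e ->
  exists K : R, (0 < K)%R /\ forall N k,
    (Cmod (term q (q ^ N * a) (q ^ N * c) e k - (if k then 1 else 0))
     <= K * Cmod q ^ N * (Cmod (a * c) ^ k * Cmod q ^ (k ^ 2 - k)))%R.
Proof.
  intro H. destruct (head_bound _ _ _ H) as [K [HK B]].
  destruct (corr_bound _ _ _ H) as [L [HL BL]].
  exists (K * (1 + L) + L)%R.
  assert (HKL : (0 < K * (1 + L))%R) by (apply Rmult_lt_0_compat; lra).
  split; [lra |].
  intros N k. unfold term. specialize (B N k). specialize (BL N k).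
  assert (Hp : (0 < Cmod q ^ N <= 1)%R) by (rewrite <- Cmod_pow; apply Cmod_qpow_le; auto).
  destruct k as [|k].
  - rewrite head_0.
    replace (1 * (1 + corr q (q ^ N * a) (q ^ N * c) e 0) - 1)
      with (corr q (q ^ N * a) (q ^ N * c) e 0) by ring.
    simpl. nra.
  - set (W := (Cmod (a * c) ^ S k * Cmod q ^ (S k ^ 2 - S k))%R) in *.
    assert (HW : (0 <= W)%R) by (apply Rmult_le_pos; apply pow_le; auto using Cmod_ge_0).
    replace (head q (q ^ N * a) (q ^ N * c) e (S k) * (1 + corr q (q ^ N * a) (q ^ N * c) e (S k)) - 0)
      with (head q (q ^ N * a) (q ^ N * c) e (S k) * (1 + corr q (q ^ N * a) (q ^ N * c) e (S k)))
      by ring.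
    apply Rle_trans with (K * ((Cmod q ^ N) ^ S k * W) * (1 + L))%R.
    + apply Cmod_mult_le; auto.
      eapply Rle_trans; [apply Cmod_triangle |]. rewrite Cmod_1. nra.
    + assert ((Cmod q ^ N) ^ S k <= Cmod q ^ N)%R.
      { simpl. assert (0 <= (Cmod q ^ N) ^ k <= 1)%R; [| nra].
        split; [apply pow_le; lra |]. rewrite <- (pow1 k). apply pow_incr. lra. }
      assert ((Cmod q ^ N) ^ S k * W <= Cmod q ^ N * W)%R by (apply Rmult_le_compat_r; auto).
      assert (0 <= Cmod q ^ N * W)%R by nra.
      apply Rle_trans with (K * (1 + L) * (Cmod q ^ N * W))%R; [| nra].
      replace (K * ((Cmod q ^ N) ^ S k * W) * (1 + L))%R
        with (K * (1 + L) * ((Cmod q ^ N) ^ S k * W))%R by ring.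
      apply Rmult_le_compat_l; nra.
Qed.

(** The termwise bounds are summed against the total [S] of the majorant series; the subtracted 1 is
    used up by the zeroth term. *)
Lemma partial_sum_bound (a c e : C) : admissible q a c e ->
  exists K : R, forall N n,
    (Cmod (sum_n (G := C_AbelianMonoid) (term q (q ^ N * a) (q ^ N * c) e) n - 1)
     <= K * Cmod q ^ N)%R.
Proof.
  intro H. destruct (term_bound _ _ _ H) as [K [HK B]].
  destruct H as (ha & hc & _).
  set (w := fun k : nat => (Cmod (a * c) ^ k * Cmod q ^ (k ^ 2 - k))%R).
  assert (Hw0 : forall k, (0 <= w k)%R)
    by (intro k; apply Rmult_le_pos; apply pow_le; auto using Cmod_ge_0).
  destruct (ex_series_weight (Cmod (a * c)) (Cmod q)) as [S HS].
  { apply Cmod_gt_0. now apply Cmult_neq_0. }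
  { lra. }
  assert (HSn : forall n, (sum_n w n <= S)%R).
  { apply is_lim_seq_incr_compare; [exact HS |].
    intro n. rewrite sum_Sn. unfold plus; simpl. specialize (Hw0 (Datatypes.S n)). lra. }
  exists (K * S)%R. intros N n.
  assert (Hp : (0 < Cmod q ^ N)%R) by now apply pow_lt.
  apply Rle_trans with (K * Cmod q ^ N * sum_n w n)%R.
  - induction n as [|n IH].
    + rewrite !sum_O. exact (B N 0%nat).
    + rewrite !sum_Sn. change (plus (G := C_AbelianMonoid)) with Cplus.
      change (plus (sum_n w n) (w (Datatypes.S n))) with (sum_n w n + w (Datatypes.S n))%R.
      rewrite Rmult_plus_distr_l.
      set (s := sum_n (term q (q ^ N * a) (q ^ N * c) e) n) in *.
      specialize (B N (Datatypes.S n)). cbv iota in B.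
      set (t := term q (q ^ N * a) (q ^ N * c) e (Datatypes.S n)) in *.
      replace (s + t - 1) with ((s - 1) + (t - 0)) by ring.
      eapply Rle_trans; [apply Cmod_triangle |].
      apply Rplus_le_compat; [exact IH | exact B].
  - specialize (HSn n).
    replace (K * S * Cmod q ^ N)%R with (K * Cmod q ^ N * S)%R by ring.
    apply Rmult_le_compat_l; nra.
Qed.

(** Comparison with the majorant series, by [term_bound] at [N = 0]; the 1 removed from the zeroth
    term is added back to the limit. *)
Lemma ex_series_term (a c e : C) : admissible q a c e ->
  exists l : C, tends (sum_n (G := C_AbelianMonoid) (term q a c e)) l.
Proof.
  intro H. destruct (term_bound _ _ _ H) as [K [HK B]].
  destruct (ex_series_le (K := C_AbsRing) (V := C_CompleteNormedModule)
    (fun k => term q a c e k - (if k then 1 else 0))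
    (fun k => K * (Cmod (a * c) ^ k * Cmod q ^ (k ^ 2 - k)))%R) as [l Hl].
  - intro k. specialize (B 0%nat k). simpl pow in B. rewrite Rmult_1_r in B.
    simpl Cpow in B. rewrite !Cmult_1_l in B. exact B.
  - apply (ex_series_scal_l (K := R_AbsRing) (V := R_NormedModule) K).
    destruct H as (ha & hc & _).
    apply ex_series_weight; [apply Cmod_gt_0; now apply Cmult_neq_0 | lra].
  - exists (l + 1).
    apply tends_ext with (fun n => sum_n (G := C_AbelianMonoid)
      (fun k => term q a c e k - (if k then 1 else 0)) n + 1).
    + induction n as [|n IH].
      * rewrite !sum_O. ring.
      * rewrite !sum_Sn. change (plus (G := C_AbelianMonoid)) with Cplus. rewrite <- IH. ring.
    + apply tends_plus; [| apply tends_const]. apply tends_filterlim. exact Hl.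
Qed.

(** The certificate is a bounded multiple of [head], which is dominated by the terms of a convergent
    series. The successor appears because the partial sum up to [n] telescopes to [G_(n+1)]. *)
Lemma certificate_tends_0 (a c e : C) : admissible q a c e ->
  tends (fun k => certificate q a c e (S k)) 0.
Proof.
  intro H. destruct (head_bound _ _ _ H) as [K [HK B]].
  destruct H as (ha & hc & he & hae & hce).
  destruct (qpoch_factor_lower _ hce) as [m [Hm L]].
  apply (tends_incr_1 (certificate q a c e)).
  apply tends_le with (fun k => Cmod ((1 - a * e) * (1 - c / e)) * K * (2 / m)
    * (Cmod (a * c) ^ k * Cmod q ^ (k ^ 2 - k)))%R.
  - intro k. unfold certificate.
    match goal with |- (Cmod (?x - _) <= _)%R => replace (x - 0) with x by ring end.
    rewrite Rmult_assoc, (Rmult_comm (2 / m)), <- Rmult_assoc.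
    apply Cmod_mult_le.
    + rewrite Rmult_assoc. apply Cmod_mult_le; [lra |].
      specialize (B 0%nat k). simpl Cpow in B. rewrite !Cmult_1_l in B.
      simpl pow in B. rewrite pow1, Rmult_1_l in B. exact B.
    (* [2] bounds [|1 - q^(2k)|], and [m] bounds the denominator from below. *)
    + apply Cmod_div_le; auto. eapply Rle_trans; [apply one_minus_upper |].
      pose proof (Cmod_qpow_le (2 * k)). lra.
  - match goal with |- is_lim_seq (fun k => (?x * _)%R) _ => replace 0%R with (x * 0)%R by ring end.
    apply is_lim_seq_mult'; [apply is_lim_seq_const |].
    apply ex_series_lim_0, ex_series_weight; [apply Cmod_gt_0; now apply Cmult_neq_0 | lra].
Qed.

(** * The q-difference equation for the sum, its iteration and its limit *)

Lemma sum_shift (a c e l l' : C) : admissible q a c e ->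
  tends (sum_n (G := C_AbelianMonoid) (term q a c e)) l ->
  tends (sum_n (G := C_AbelianMonoid) (term q (q * a) (q * c) e)) l' ->
  (1 - a * e) * (1 - c / e) * l = (1 - a) * (1 - c) * l'.
Proof.
  intros H Hl Hl'.
  apply tends_unique with (fun n => (1 - a * e) * (1 - c / e)
    * sum_n (G := C_AbelianMonoid) (term q a c e) n).
  { apply tends_mult; auto using tends_const. }
  apply tends_ext with (fun n => (1 - a) * (1 - c)
    * sum_n (G := C_AbelianMonoid) (term q (q * a) (q * c) e) n + -1 * certificate q a c e (S n)).
  - intro n. induction n as [|n IH].
    + rewrite !sum_O. pose proof (term_telescopes a c e 0 H) as E.
      (* [G_0] vanishes through its factor [1 - q ^ 0]. *)
      replace (certificate q a c e 0) with (RtoC 0) in E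
        by (unfold certificate, Cdiv; simpl; ring).
      match type of E with ?x - ?y = ?z => replace x with (z + y) by (rewrite <- E; ring) end.
      ring.
    + rewrite !sum_Sn. change (plus (G := C_AbelianMonoid)) with Cplus.
      rewrite (Cmult_plus_distr_l _ _ (term q a c e (S n))), <- IH.
      pose proof (term_telescopes a c e (S n) H) as E.
      match type of E with ?x - ?y = ?z => replace x with (z + y) by (rewrite <- E; ring) end.
      ring.
  - replace ((1 - a) * (1 - c) * l') with ((1 - a) * (1 - c) * l' + -1 * 0) by ring.
    auto using tends_plus, tends_mult, tends_const, certificate_tends_0.
Qed.

(** Each use of the q-difference equation, at [(q^N a, q^N c)], appends one factor to each of the
    four q-shifted factorials. *)
Lemma sum_shift_iter (a c e l l' : C) (N : nat) : admissible q a c e ->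
  tends (sum_n (G := C_AbelianMonoid) (term q a c e)) l ->
  tends (sum_n (G := C_AbelianMonoid) (term q (q ^ N * a) (q ^ N * c) e)) l' ->
  qpoch (a * e) q N * qpoch (c / e) q N * l = qpoch a q N * qpoch c q N * l'.
Proof.
  intros H Hl. revert l'. induction N as [|N IH]; intros l' Hl'.
  - simpl in Hl'. rewrite !Cmult_1_l in Hl'. simpl. f_equal. now apply (tends_unique _ _ _ Hl).
  - assert (HN := admissible_iter _ _ _ N H).
    destruct (ex_series_term _ _ _ HN) as [t Ht].
    rewrite !Cpow_S, <- !Cmult_assoc in Hl'.
    pose proof (sum_shift _ _ _ _ _ HN Ht Hl') as E.
    specialize (IH t Ht). simpl.
    replace (q ^ N * (a * e)) with (q ^ N * a * e) by ring.
    replace (q ^ N * (c / e)) with (q ^ N * c / e) by (unfold Cdiv; ring).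
    transitivity (qpoch (a * e) q N * qpoch (c / e) q N * l
      * ((1 - q ^ N * a * e) * (1 - q ^ N * c / e))); [ring |].
    rewrite IH.
    transitivity (qpoch a q N * qpoch c q N
      * ((1 - q ^ N * a * e) * (1 - q ^ N * c / e) * t)); [ring |].
    rewrite E. ring.
Qed.

(** The bound on partial sums is uniform in [n], so it passes to the limit through the triangle
    inequality. *)
Lemma sum_term_near_1 (a c e : C) : admissible q a c e ->
  exists K : R, forall N t,
    tends (sum_n (G := C_AbelianMonoid) (term q (q ^ N * a) (q ^ N * c) e)) t ->
    (Cmod (t - 1) <= K * Cmod q ^ N)%R.
Proof.
  intros H. destruct (partial_sum_bound _ _ _ H) as [K B].
  exists K. intros N t Ht.
  assert (L : Rbar_le (Cmod (t - 1)) (0 + K * Cmod q ^ N)%R); [| simpl in L; lra].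
  apply is_lim_seq_le with (fun _ : nat => Cmod (t - 1))
    (fun n => Cmod (sum_n (G := C_AbelianMonoid) (term q (q ^ N * a) (q ^ N * c) e) n - t)
              + K * Cmod q ^ N)%R.
  - intro n. specialize (B N n). revert B.
    generalize (sum_n (G := C_AbelianMonoid) (term q (q ^ N * a) (q ^ N * c) e) n). intros s B.
    replace (t - 1) with ((s - 1) + - (s - t)) by ring.
    eapply Rle_trans; [apply Cmod_triangle |]. rewrite Cmod_opp. lra.
  - apply is_lim_seq_const.
  - apply is_lim_seq_plus'; [apply Ht | apply is_lim_seq_const].
Qed.

(** By the iterated equation, [(ae;q)_N (c/e;q)_N l - (a;q)_N (c;q)_N] equals
    [(a;q)_N (c;q)_N (t - 1)] with [t] the shifted sum. This tends to 0, while the left side tends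
    to the difference of the two sides of the claim. *)
Lemma sum_term (a c e l : C) : admissible q a c e ->
  tends (sum_n (G := C_AbelianMonoid) (term q a c e)) l ->
  qpoch_inf (a * e) q * qpoch_inf (c / e) q * l = qpoch_inf a q * qpoch_inf c q.
Proof.
  intros H Hl. destruct (sum_term_near_1 _ _ _ H) as [K B].
  destruct (qpoch_upper a) as [M [HM BM]].
  destruct (qpoch_upper c) as [M' [HM' BM']].
  assert (D : tends (fun N => qpoch (a * e) q N * qpoch (c / e) q N * l
                              + -1 * (qpoch a q N * qpoch c q N)) 0).
  { apply tends_le with (fun N => M * M' * K * Cmod q ^ N)%R.
    - intro N. destruct (ex_series_term _ _ _ (admissible_iter _ _ _ N H)) as [t Ht].
      rewrite (sum_shift_iter _ _ _ _ _ N H Hl Ht).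
      match goal with |- (Cmod ?z <= _)%R =>
        replace z with (qpoch a q N * qpoch c q N * (t - 1)) by ring end.
      rewrite Rmult_assoc. auto using Cmod_mult_le.
    - replace 0%R with (M * M' * K * 0)%R by ring.
      apply is_lim_seq_mult'; [apply is_lim_seq_const |].
      apply is_lim_seq_geom. rewrite Rabs_pos_eq; lra. }
  assert (D' : tends (fun N => qpoch (a * e) q N * qpoch (c / e) q N * l
                               + -1 * (qpoch a q N * qpoch c q N))
    (qpoch_inf (a * e) q * qpoch_inf (c / e) q * l + -1 * (qpoch_inf a q * qpoch_inf c q)))
    by auto 8 using tends_plus, tends_mult, tends_const, qpoch_cvg.
  pose proof (tends_unique _ _ _ D D') as E.
  match goal with |- ?x = ?y => replace x with (x + -1 * y + y) by ring end.
  rewrite <- E. ring.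
Qed.

End ContractingBase.

Theorem theorem1 (q a c e : C)
  (hq0 : (0 < Cmod q)%R) (hq1 : (Cmod q < 1)%R)
  (ha : a <> 0) (hc : c <> 0) (he : e <> 0)
  (hae : forall n : nat, qpoch (a * e) q n <> 0)
  (hce : forall n : nat, qpoch (c / e) q n <> 0) :
  is_series (K := C_AbsRing) (V := C_NormedModule)
    (fun k : nat =>
       (a * c) ^ k / qpoch q q (2 * k)
       * (qpoch e q k * qpoch (a * e / c) q k / qpoch (a * e) q k)
       * (qpoch (q / e) q k * qpoch (q * c / (a * e)) q k / qpoch (c / e) q k)
       * q ^ (k ^ 2 - k)
       * (1 + q ^ k * (c * (1 - q ^ k * e) * (1 - q ^ k * (a * e / c))
                       / (e * (1 - q ^ (1 + 2 * k)) * (1 - q ^ k * (c / e))))))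
    (qpoch_inf a q * qpoch_inf c q
     / (qpoch_inf (a * e) q * qpoch_inf (c / e) q)).
Proof.
  assert (H : admissible q a c e) by (repeat split; assumption).
  destruct (ex_series_term q hq0 hq1 a c e H) as [l Hl].
  apply tends_filterlim.
  replace (qpoch_inf a q * qpoch_inf c q / (qpoch_inf (a * e) q * qpoch_inf (c / e) q)) with l.
  - exact Hl.
  (* Only here is the product form divided through, the two infinite products in the denominator
     being nonzero. *)
  - rewrite <- (sum_term q hq0 hq1 a c e l H Hl). field.
    split; now apply qpoch_inf_neq0.
Qed.
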